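(* For any given graph $G$ with at least one edge, as functions of $d$, $$\mathrm{boxicity}(G^{\Box d}) \in O\left(\frac{\log d}{\log\log d}\right)\cap \Omega(\log\log d)$$ and $$\mathrm{cubicity}(G^{\Box d}) \in \Theta\left(\frac{d}{\log d}\right).$$
   Context: All graphs are finite, undirected and simple. All logarithms are to base $2$. A $k$-box is a Cartesian product of $k$ closed intervals of $\mathbb{R}$, and a $k$-cube is a Cartesian product of $k$ closed intervals of unit length. A $k$-box ($k$-cube) representation of a graph $G$ is a function $f$ mapping each vertex to a $k$-box ($k$-cube) such that for any two distinct vertices $u,v$, $uv\in E(G)$ if and only if $f(u)\cap f(v)\neq\emptyset$. The boxicity (cubicity) of $G$ is the smallest natural number $k$ (with $0$ allowed; complete graphs have boxicity and cubicity $0$) such that $G$ has a $k$-box ($k$-cube) representation. The Cartesian product $G_1\Box G_2$ is the graph on $V(G_1)\times V(G_2)$ in which $(u_1,u_2)$ and $(v_1,v_2)$ are adjacent iff ($u_1=v_1$ and $u_2v_2\in E(G_2)$) or ($u_1v_1\in E(G_1)$ and $u_2=v_2$). $G^{\Box d}$ is the Cartesian product of $d$ copies of $G$. The graph $G$ is fixed and asymptotics are as $d\to\infty$; implied constants may depend on $G$. *)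

(* Defs.v *)
From HB Require Import structures.
From mathcomp Require Import all_boot all_order all_algebra.
From mathcomp Require Import all_classical all_reals all_analysis.

Set Implicit Arguments.
Unset Strict Implicit.
Unset Printing Implicit Defensive.

Import Order.TTheory GRing.Theory Num.Theory.
Import numFieldNormedType.Exports.

Local Open Scope classical_set_scope.
Local Open Scope ring_scope.

Record sgraph := SGraph {
  vertex :> finType;
  adj : rel vertex;
  adj_sym : symmetric adj;
  adj_irr : irreflexive adj }.

Section CartesianProduct.
Variables G1 G2 : sgraph.

Definition cart_adj : rel (G1 * G2) := fun u v =>
  ((u.1 == v.1) && adj u.2 v.2) || (adj u.1 v.1 && (u.2 == v.2)).

Lemma cart_adj_sym : symmetric cart_adj.
Proof.
move=> u v; rewrite /cart_adj (eq_sym u.1) (eq_sym u.2).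
by rewrite (adj_sym u.1) (adj_sym u.2).
Qed.

Lemma cart_adj_irr : irreflexive cart_adj.
Proof. by move=> u; rewrite /cart_adj !adj_irr andbF. Qed.

Definition cart_prod : sgraph := SGraph cart_adj_sym cart_adj_irr.

End CartesianProduct.

Definition K1 : sgraph :=
  @SGraph unit (fun _ _ => false) (fun _ _ => erefl) (fun _ => erefl).

(* The empty product is the one-vertex graph, the unit of the Cartesian
   product up to isomorphism. *)
Definition cart_pow (G : sgraph) (d : nat) : sgraph :=
  iter d (cart_prod G) K1.

Section Boxes.
Variable R : realType.

(* Closed intervals are nonempty; the only 0-box (and the only 0-cube) is the
   one-point space 'rV[R]_0. *)
Definition is_box (k : nat) (B : set 'rV[R]_k) : Prop :=
  exists a b : 'I_k -> R, (forall i, a i <= b i) /\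
    B = [set x | forall i, x ord0 i \in `[a i, b i]].

Definition is_cube (k : nat) (B : set 'rV[R]_k) : Prop :=
  exists a : 'I_k -> R,
    B = [set x | forall i, x ord0 i \in `[a i, a i + 1]].

Definition intersection_rep (G : sgraph) (X : Type) (f : G -> set X) : Prop :=
  forall u v : G, u != v -> (adj u v <-> f u `&` f v !=set0).

Definition has_box_rep (G : sgraph) (k : nat) : Prop :=
  exists f : G -> set 'rV[R]_k,
    (forall v, is_box (f v)) /\ intersection_rep f.

Definition has_cube_rep (G : sgraph) (k : nat) : Prop :=
  exists f : G -> set 'rV[R]_k,
    (forall v, is_cube (f v)) /\ intersection_rep f.

Lemma cube_is_box (k : nat) (B : set 'rV[R]_k) : is_cube B -> is_box B.
Proof.
by move=> [a ->]; exists a, (fun i => a i + 1); split=> // i; rewrite lerDl.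
Qed.

(* One coordinate per vertex w: the cube of w projects to [0, 1], those of the
   neighbours of w to [1, 2], and those of the other vertices to [2, 3]. *)
Lemma has_cube_rep_card (G : sgraph) : has_cube_rep G #|G|.
Proof.
pose p (w u : G) : R := if u == w then 0 else if adj w u then 1 else 2.
have p_le w u v : adj u v -> p w u <= p w v + 1.
  move=> auv; rewrite /p; have [vw|_] := eqVneq v w.
    rewrite -vw adj_sym auv add0r; case: ifP => _; by rewrite ?ler01.
  apply: (@le_trans _ _ 2); first by do 2?case: ifP => _; rewrite ?ler1n ?ler0n.
  by case: ifP => _; rewrite ?lerDl // -[leLHS]/(1 + 1).
exists (fun u => [set x : 'rV[R]_#|G| |
  forall i, x ord0 i \in `[p (enum_val i) u, p (enum_val i) u + 1]]).
split=> [u|u v uv]; first by exists (fun i => p (enum_val i) u).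
split=> [auv|[x [/= /(_ (enum_rank u)) xu /(_ (enum_rank u)) xv]]].
  exists (\row_i Num.max (p (enum_val i) u) (p (enum_val i) v)).
  have avu : adj v u by rewrite adj_sym.
  split=> i /=; rewrite mxE in_itv /= le_max ge_max lexx ?orbT /= lerDl ler01.
    exact: p_le.
  by rewrite p_le.
apply/negPn/negP => auv; move: xu xv.
rewrite enum_rankK !in_itv /= /p eqxx eq_sym (negPf uv) (negPf auv) add0r.
move=> /andP[_ x1] /andP[x2 _].
by have := le_trans x2 x1; rewrite (ler_nat R 2 1).
Qed.

Lemma ex_cube_rep (G : sgraph) : exists k, `[< has_cube_rep G k >].
Proof. by exists #|G|; apply/asboolP/has_cube_rep_card. Qed.

Lemma ex_box_rep (G : sgraph) : exists k, `[< has_box_rep G k >].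
Proof.
exists #|G|; apply/asboolP; have [f [fc fr]] := has_cube_rep_card G.
by exists f; split=> // v; apply/cube_is_box/fc.
Qed.

Definition boxicity (G : sgraph) : nat := ex_minn (ex_box_rep G).

Definition cubicity (G : sgraph) : nat := ex_minn (ex_cube_rep G).

Definition log2 (x : R) : R := ln x / ln 2.

End Boxes.

(* Main.v *)
(* Intervals: all graphs are represented by pairs of functions (l, r) whose
   interval graphs contain the given graph; boxicity (cubicity) is the least
   number of such (unit) interval graphs separating every nonadjacent pair.

   Upper bounds. Words at Hamming distance 1 are handled by boundedly many unit
   interval graphs, and words at larger distance are pulled back along the maps
   induced by G -> bool from the hypercube. In the hypercube, nonadjacent sets of
   different parity are separated by comparing weights w(S) and w(T) on classes
   modulo 4. When d <= k!, 2k weights suffice: identify points with branches of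
   a tree in which the root has k children, their children k - 1, and so on; the
   i-th weight gives priority to the i-th branch wherever that branch is still
   available. If T - S has total mass 1 and meets two classes at a node, some
   class that it meets has mass at most 0, and the weight favouring that class
   reverses the pair. Sets of equal parity take two more interval graphs, or, with
   unit intervals, a coin-weighing (detecting) matrix with O(d / log d) rows.

   Lower bounds. For boxicity, colour the pairs i < j by the order of the
   endpoints of the boxes of {i} and {j}; a monochromatic path i < j < m puts
   {j} between {i} and {m} in all orders, so the box of {i, m} meets that of {j}.
   For cubicity, the cubes lie in a box of side O(d), and rounding the
   coordinates is injective on sets of a given parity. *)
Require Import Defs.
From HB Require Import structures.
From mathcomp Require Import all_boot all_order all_algebra.
From mathcomp Require Import all_classical all_reals all_analysis.
From mathcomp Require Import zify ring lra.

Set Implicit Arguments.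
Unset Strict Implicit.
Unset Printing Implicit Defensive.

Import Order.TTheory GRing.Theory Num.Theory.
Import numFieldNormedType.Exports.

Local Open Scope ring_scope.

(** * Weights reversing incomparable pairs, and detecting matrices *)

Definition sign_vector (T : finType) (z : T -> int) := forall x, `|z x| <= 1.

(** Modulo 2 only the first term survives, so [z ord0] is even, hence 0; halving removes that
    term. *)
Lemma pow2_sum_eq0 n (z : 'I_n -> int) : sign_vector z ->
  \sum_(i < n) 2 ^+ i * z i = 0 -> forall i, z i = 0.
Proof.
elim: n z => [z _ _ []//|n IHn z z1]; rewrite big_ord_recl expr0 mul1r.
under eq_bigr do rewrite exprS -mulrA.
rewrite -mulr_sumr; set s := \sum_(i < n) _ => zs0.
have z0 : z ord0 = 0 by have := z1 ord0; lia.
have s0 : s = 0 by lia.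
move=> i; case: (unliftP ord0 i) => [j ->|->//].
by apply: (IHn (fun j => z (lift ord0 j))) s0 j => j; exact: z1.
Qed.

Lemma pow2_rank_sum_eq0 (T : finType) (z : T -> int) : sign_vector z ->
  \sum_(x : T) 2 ^+ enum_rank x * z x = 0 -> forall x, z x = 0.
Proof.
move=> z1 z0 x; rewrite -(enum_rankK x).
apply: (@pow2_sum_eq0 _ (z \o enum_val)) => [i|]; first exact: z1.
rewrite -{}[RHS]z0 [RHS](reindex (@enum_val T predT)) /=.
  by apply: eq_bigr => i _; rewrite enum_valK.
by exists enum_rank => i _; [exact: enum_valK|exact: enum_rankK].
Qed.

Lemma ler_norm_sum_sign (T : finType) (P : pred T) (w z : T -> int) :
    (forall x, 0 <= w x) -> sign_vector z ->
  `|\sum_(x | P x) w x * z x| <= \sum_(x | P x) w x.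
Proof.
move=> w0 z1; apply: le_trans (ler_norm_sum _ _ _) _; apply: ler_sum => x _.
by rewrite normrM (ger0_norm (w0 x)) ler_piMr.
Qed.

Section Extension.
Variables (T E : finType) (f : T -> E) (z : T -> int).
Hypothesis f_inj : injective f.

(** For injective [f] a fibre has at most one point, so this is extension by zero. *)
Definition extend (y : E) : int := \sum_(x | f x == y) z x.

Lemma extendE x : extend (f x) = z x.
Proof.
by rewrite /extend (eq_bigl (pred1 x)) ?big_pred1_eq // => y; rewrite inj_eq.
Qed.

Lemma sum_extend (a : E -> int) :
  \sum_y a y * extend y = \sum_x a (f x) * z x.
Proof.
rewrite [RHS](partition_big f xpredT) //=; apply: eq_bigr => y _.
by rewrite /extend mulr_sumr; apply: eq_bigr => x /eqP ->.
Qed.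

Lemma sign_extend : sign_vector z -> sign_vector extend.
Proof.
move=> z1 y; have [/codomP[x ->]|yf] := boolP (y \in codom f).
  by rewrite extendE.
by rewrite /extend big1 // => x /eqP fx; rewrite -fx codom_f in yf.
Qed.

End Extension.

(* For z the difference of the indicators of T and S, the hypotheses on z read
   #|T| = #|S| + 1 and ~~ (S \subset T), and the conclusion w(T) <= w(S). *)
Definition reversing (I E : finType) (w : I -> E -> int) :=
  (forall i x, 0 < w i x) /\
  forall z : E -> int, sign_vector z -> \sum_x z x = 1 ->
    (exists x, z x < 0) -> exists i, \sum_x w i x * z x <= 0.

Lemma reversing_comp (I E T : finType) (w : I -> E -> int) (f : T -> E) :
  injective f -> reversing w -> reversing (fun i x => w i (f x)).
Proof.
move=> f_inj [w0 wP]; split=> [i x|z z1 zs [x zx]]; first exact: w0.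
have [||| i] := wP (extend f z).
- exact: sign_extend.
- have := sum_extend f z (fun=> 1).
  under eq_bigr do rewrite mul1r.
  by move->; under eq_bigr do rewrite mul1r.
- by exists (f x); rewrite extendE.
- by rewrite sum_extend => wi; exists i.
Qed.

Section ReversingStep.
Variables (E : finType) (k : nat) (w : bool * 'I_k -> E -> int).
Hypothesis w_rev : reversing w.

(** A class other than the favoured letter [bi.2] inherits the previous weight for that letter,
    renumbered among the letters that remain below the class; the default 0 falls on the favoured
    class itself. *)
Let tail (bi : bool * 'I_k.+1) (cx : 'I_k.+1 * E) : int :=
  if unlift cx.1 bi.2 is Some j then w (bi.1, j) cx.2 else 0.

(* Summed over a class, this compares masses first and then, for one of the two
   signs b, favours the wanted side by the uniqueness of binary expansions. *)
Let top (b : bool) (x : E) : int :=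
  1 + \sum_(y : E) 2 ^+ enum_rank y + (-1) ^+ b * 2 ^+ enum_rank x.

(** The factor exceeds the total weight of the other classes, so a value at most -1 on the favoured
    class cannot be compensated. *)
Definition reversing_next (bi : bool * 'I_k.+1) (cx : 'I_k.+1 * E) : int :=
  if cx.1 == bi.2 then (1 + \sum_cy tail bi cy) * top bi.1 cx.2
  else tail bi cx.

Let tail_ge0 bi cx : 0 <= tail bi cx.
Proof. by rewrite /tail; case: unlift => // j; apply/ltW; case: w_rev. Qed.

Let tail_gt0 bi cx : cx.1 != bi.2 -> 0 < tail bi cx.
Proof.
rewrite /tail; case: unliftP => [j _ _|->]; last by rewrite eqxx.
by case: w_rev.
Qed.

Let pow2_ge0 (x : E) : 0 <= 2 ^+ enum_rank x :> int.
Proof. exact: exprn_ge0. Qed.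

Let top_gt0 b x : 0 < top b x.
Proof.
rewrite /top (bigD1 x) //=.
have : 0 <= \sum_(y | y != x) 2 ^+ enum_rank y :> int by exact: sumr_ge0.
move: (pow2_ge0 x); set s := \sum_(y | _) _; move: (2 ^+ _) s => p s p0 s0.
by case: b; rewrite ?expr0 ?expr1; lia.
Qed.

Lemma reversing_next_gt0 bi cx : 0 < reversing_next bi cx.
Proof.
rewrite /reversing_next; case: eqP => [_|/eqP]; last exact: tail_gt0.
rewrite mulr_gt0 // ltr_pwDl // sumr_ge0 // => *; exact: tail_ge0.
Qed.

(** If the mass is negative, its coefficient [1 + L] outweighs [p]; if it is 0, then [p] is nonzero
    and [b] chooses its sign. *)
Let class_top (z : E -> int) : sign_vector z -> \sum_x z x <= 0 ->
  (exists x, z x != 0) -> exists b, \sum_x top b x * z x <= -1.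
Proof.
move=> z1 zs [x zx]; pose p := \sum_(x : E) 2 ^+ enum_rank x * z x.
pose L : int := \sum_(x : E) 2 ^+ enum_rank x.
have topE b : \sum_x top b x * z x = (1 + L) * (\sum_x z x) + (-1) ^+ b * p.
  rewrite !mulr_sumr -big_split; apply: eq_bigr => y _ /=.
  by rewrite /top mulrDl mulrA.
have p_le : `|p| <= L by exact: ler_norm_sum_sign.
have p0 : p != 0 by apply: contraNneq zx => /(pow2_rank_sum_eq0 z1) ->.
move: zs topE; set s := \sum_x z x; move=> zs topE.
have [s0|s0] := eqVneq s 0.
  have [p_ge0|p_lt0] := leP 0 p; [exists true|exists false];
    by rewrite topE s0 ?expr0 ?expr1; lia.
exists false; rewrite topE; have s1 : s <= -1 by lia.
have : (1 + L) * s <= (1 + L) * -1 by rewrite ler_wpM2l //; lia.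
by rewrite expr0; lia.
Qed.

Lemma reversing_nextP : reversing reversing_next.
Proof.
split=> [|z z1 zs [[c x] zcx]]; first exact: reversing_next_gt0.
pose Z c := \sum_x z (c, x).
have ZE : \sum_c Z c = 1.
  by rewrite -zs pair_bigA; apply: eq_bigr => -[].
have sumE bi : \sum_cx reversing_next bi cx * z cx =
    \sum_c \sum_x reversing_next bi (c, x) * z (c, x).
  by rewrite pair_bigA; apply: eq_bigr => -[].
(* Favouring a class [c0] of mass at most 0 that [z] meets: it contributes at most [- (1 + B)], the
   other classes at most [B]. *)
have [/existsP[c0 /andP[Zc0 /existsP[x0 zc0]]]|] :=
    boolP [exists c, (Z c <= 0) && [exists x, z (c, x) != 0]].
  have [|b tb] := @class_top (fun x => z (c0, x)) (fun=> z1 _) Zc0.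
    by exists x0.
  exists (b, c0); pose B := \sum_cy tail (b, c0) cy.
  have restE :
      \sum_c \sum_x (if c == c0 then 0 else tail (b, c0) (c, x) * z (c, x)) =
      \sum_cx tail (b, c0) cx * z cx.
    rewrite pair_bigA; apply: eq_bigr => -[c1 x1] _ /=.
    by case: eqP => // ->; rewrite /tail /= unlift_none mul0r.
  have rest_le : `|\sum_cx tail (b, c0) cx * z cx| <= B.
    exact: ler_norm_sum_sign.
  rewrite sumE (bigD1 c0) //=; under [X in _ + X]eq_bigr => c1 c1c0.
    under eq_bigr => x1 _.
      rewrite /reversing_next /= (negPf c1c0).
      over.
    over.
  have -> : \sum_(c1 | c1 != c0) \sum_x1 tail (b, c0) (c1, x1) * z (c1, x1) =
      \sum_cx tail (b, c0) cx * z cx.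
    rewrite -restE [RHS](bigD1 c0) //= eqxx big1_eq add0r.
    by apply: eq_bigr => c1 /negPf ->.
  have -> : \sum_x reversing_next (b, c0) (c0, x) * z (c0, x) =
      (1 + B) * \sum_x top b x * z (c0, x).
    rewrite mulr_sumr; apply: eq_bigr => y _.
    by rewrite /reversing_next /= eqxx mulrA.
  have B0 : 0 <= B by apply: sumr_ge0 => *; exact: tail_ge0.
  move: tb; set s := \sum_x _ => tb.
  have : (1 + B) * s <= (1 + B) * -1 by rewrite ler_wpM2l //; lia.
  by move: rest_le; set r := \sum_cx _; lia.
(* Now every class that [z] meets has positive integer mass. The masses add up to 1, so [z] lives on
   one class [c] of mass 1, where the previous level applies. *)
move=> /existsPn Zn.
have Zpos c' x' : z (c', x') != 0 -> 0 < Z c'.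
  move=> zc'; rewrite ltNge; apply: contra (Zn c') => -> /=.
  by apply/existsP; exists x'.
have Zge0 c' : 0 <= Z c'.
  have [/existsP[x' /Zpos/ltW//]|/existsPn zx] :=
    boolP [exists x, z (c', x) != 0].
  by rewrite /Z big1 // => x' _; apply/eqP/negPn/zx.
have Zc : 0 < Z c by apply: Zpos (x) _; rewrite lt_eqF.
have rest0 : \sum_(c' | c' != c) Z c' = 0.
  have : 0 <= \sum_(c' | c' != c) Z c' by exact: sumr_ge0.
  by move: ZE Zc; rewrite (bigD1 c) //=; move: (Z c) (\sum_(_ | _) _); lia.
have Zc1 : Z c = 1 by move: ZE; rewrite (bigD1 c) //= rest0 addr0.
have z0 c' x' : c' != c -> z (c', x') = 0.
  move=> c'c; apply/eqP; apply: contraTT isT => /Zpos.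
  by move/psumr_eq0P: rest0 => -> //; rewrite ltxx.
have [_ /(_ (fun x => z (c, x)))] := w_rev.
case=> [y||| [b j] wz]; [exact: z1|by []|by exists x|].
exists (b, lift c j); rewrite sumE (bigD1 c) //= [X in _ + X]big1.
  rewrite addr0 (eq_bigr (fun x => w (b, j) x * z (c, x))) // => y _.
  by rewrite /reversing_next /= (negPf (neq_lift c j)) /tail liftK.
by move=> c' c'c; rewrite big1 // => y _; rewrite z0 ?mulr0.
Qed.

End ReversingStep.

(* A vertex of the tree of partial injective words over 'I_k: the letter chosen
   at each level is indexed among those not used before. *)
Fixpoint perm_code k : finType :=
  if k is k'.+1 then ('I_k * perm_code k')%type else unit.

Lemma card_perm_code k : #|perm_code k| = k`!.
Proof. by elim: k => [|k IHk] /=; rewrite ?card_unit // card_prod card_ord IHk. Qed.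

Lemma reversing_perm_code k :
  exists w : bool * 'I_k -> perm_code k -> int, reversing w.
Proof.
elim: k => [|k [w /reversing_nextP wP]]; last by exists (reversing_next w).
exists (fun _ _ => 1); split=> // z _; rewrite (big_pred1 tt) => [|[]//] z1.
by case=> -[]; rewrite z1.
Qed.

Lemma card_le_inj (T E : finType) : (#|T| <= #|E|)%N ->
  exists f : T -> E, injective f.
Proof.
move=> TE; exists (fun x => enum_val (widen_ord TE (enum_rank x))).
by move=> x y /enum_val_inj/(congr1 val)/= /val_inj/enum_rank_inj.
Qed.

Lemma exists_reversing k d : (d <= k`!)%N ->
  exists w : bool * 'I_k -> 'I_d -> int, reversing w.
Proof.
rewrite -card_perm_code -{1}[d]card_ord => /card_le_inj[f f_inj].
have [w /(reversing_comp f_inj) wP] := reversing_perm_code k.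
by exists (fun i x => w i (f x)).
Qed.

(** The coin-weighing condition: differences of indicators are sign vectors, so the row sums tell
    all subsets of [E] apart. *)
Definition detecting (I E : finType) (a : I -> E -> int) :=
  forall z : E -> int, sign_vector z ->
    (forall i, \sum_x a i x * z x = 0) -> forall x, z x = 0.

Lemma detecting_comp (I E T : finType) (a : I -> E -> int) (f : T -> E) :
  injective f -> detecting a -> detecting (fun i x => a i (f x)).
Proof.
move=> f_inj aP z z1 az x; rewrite -(extendE z f_inj); apply: aP.
  exact: sign_extend.
by move=> i; rewrite sum_extend.
Qed.

(* det_mx k.+1 is the block matrix [[A, A, I], [A, -A, 0]] with A := det_mx k. A
   sign vector (x, y, t) in its kernel has t = - 2 A x, hence t = 0. *)
Fixpoint det_row k : finType :=
  if k is k'.+1 then (bool * det_row k')%type else unit.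

Fixpoint det_col k : finType :=
  if k is k'.+1 then (det_col k' + det_col k' + det_row k')%type else unit.

Fixpoint det_mx k : det_row k -> det_col k -> int :=
  if k is k'.+1 return det_row k -> det_col k -> int then fun bi x =>
    match x with
    | inl (inl y) => det_mx bi.2 y
    | inl (inr y) => (-1) ^+ bi.1 * det_mx bi.2 y
    | inr j => (~~ bi.1 && (bi.2 == j))%:R
    end
  else fun _ _ => 1.

Lemma card_det_row (k : nat) : #|det_row k| = (2 ^ k)%N.
Proof.
by elim: k => [|k IHk] /=; rewrite ?card_unit // card_prod card_bool IHk expnS.
Qed.

(** The columns outnumber the [2 ^ k] rows by a factor [k.+2 / 2], the source of the logarithm saved
    in the cubicity bound. *)
Lemma card_det_col (k : nat) : (#|det_col k| * 2 = 2 ^ k * k.+2)%N.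
Proof.
elim: k => [|k IHk] /=; first by rewrite card_unit.
by rewrite !card_sum card_det_row expnS; lia.
Qed.

Lemma det_mx_sign (k : nat) (i : det_row k) (x : det_col k) :
  det_mx i x \in [:: -1; 0; 1 : int].
Proof.
elim: k i x => [|k IHk] //= [b i] [[x|x]|j] /=.
- exact: IHk.
- have := IHk i x; rewrite !inE.
  by case: b => /or3P[] /eqP ->; rewrite ?expr0 ?expr1 ?mul1r.
- by case: (_ && _).
Qed.

Lemma det_mx_detecting (k : nat) : detecting (@det_mx k).
Proof.
elim: k => [|k IHk] /= z z1 az.
  by case; have := az tt; rewrite (big_pred1 tt) ?mul1r => [|[]].
pose s1 i := \sum_x det_mx i x * z (inl (inl x)).
pose s2 i := \sum_x det_mx i x * z (inl (inr x)).
have aT i : s1 i - s2 i = 0.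
  rewrite -[RHS](az (true, i)) !big_sumType /= [X in _ = _ + X]big1.
    rewrite addr0 -sumrN; congr (_ + _).
    by apply: eq_bigr => x _; rewrite expr1 mulN1r mulNr.
  by move=> j _; rewrite mul0r.
have aF i : s1 i + s2 i + z (inr i) = 0.
  rewrite -[RHS](az (false, i)) !big_sumType /=; congr (_ + _ + _).
    by apply: eq_bigr => x _; rewrite expr0 mul1r.
  rewrite (bigD1 i) //= eqxx mul1r big1 ?addr0 // => j ji.
  by rewrite eq_sym (negPf ji) mul0r.
have zr i : z (inr i) = 0.
  by have := z1 (inr i); have := aT i; have := aF i; lia.
have s10 i : s1 i = 0 by have := aT i; have := aF i; rewrite zr; lia.
have s20 i : s2 i = 0 by have := aT i; rewrite s10; lia.
case=> [[x|x]|i] //.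
  by apply: (IHk (fun x => z (inl (inl x)))) => // y; exact: z1.
by apply: (IHk (fun x => z (inl (inr x)))) => // y; exact: z1.
Qed.

(* Entries in {-1, 0, 1} are half the sum of two signs. *)
Lemma detecting_signs (I E : finType) (a : I -> E -> int) :
    (forall i x, a i x \in [:: -1; 0; 1]) -> detecting a ->
  exists b : bool * I -> E -> bool, detecting (fun i x => (-1) ^+ b i x).
Proof.
move=> a1 aP.
exists (fun bi x => if bi.1 then a bi.2 x == -1 else a bi.2 x != 1).
move=> z z1 az; apply: aP => // i.
have h1 := az (true, i); have h0 := az (false, i).
suff : 2 * \sum_x a i x * z x = 0 by move: (\sum_x _); lia.
rewrite -[RHS](addr0 0) -[X in _ = X + _]h0 -[X in _ = _ + X]h1 mulr_sumr -big_split /=.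
apply: eq_bigr => x _; rewrite -mulrDl mulrA; congr (_ * _).
by have := a1 i x; rewrite !inE => /or3P[] /eqP ->.
Qed.

Lemma exists_detecting k d : (d * 2 <= 2 ^ k * k.+2)%N ->
  exists b : bool * det_row k -> 'I_d -> bool,
    detecting (fun i x => (-1) ^+ b i x).
Proof.
rewrite -card_det_col leq_pmul2r // -{1}[d]card_ord => /card_le_inj[f f_inj].
have [b /(detecting_comp f_inj) bP] :=
  detecting_signs (@det_mx_sign k) (@det_mx_detecting k).
by exists (fun i x => b i (f x)).
Qed.

(** * Separation by interval graphs *)

Section Separation.
Variable R : realFieldType.

Definition separates (V : Type) (l r : V -> R) (u v : V) : Prop :=
  r u < l v \/ r v < l u.

(* The relation e need not be symmetric: it stands for its symmetric closure. *)
Definition interval_supergraph (unit : bool) (V : Type) (e : V -> V -> Prop)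
    (l r : V -> R) :=
  [/\ forall u, l u <= r u, unit -> forall u, r u = l u + 1 &
      forall u v, e u v -> l u <= r v /\ l v <= r u].

(** With the pairs [P] as a parameter, bounds add up over a cover of the nonadjacent pairs. *)
Definition separable (unit : bool) (V : Type) (e P : V -> V -> Prop) (k : nat) :=
  exists l r : 'I_k -> V -> R,
    (forall i, interval_supergraph unit e (l i) (r i)) /\
    forall u v, P u v -> exists i, separates (l i) (r i) u v.

Lemma separable_fin unit V (e P : V -> V -> Prop) (I : finType)
    (l r : I -> V -> R) :
    (forall i, interval_supergraph unit e (l i) (r i)) ->
    (forall u v, P u v -> exists i, separates (l i) (r i) u v) ->
  separable unit e P #|I|.
Proof.
move=> lr lrP; exists (l \o enum_val), (r \o enum_val).
split=> [i|u v /lrP[i uv]]; first exact: lr.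
by exists (enum_rank i); rewrite /= enum_rankK.
Qed.

Lemma separable_sub unit V (e P Q : V -> V -> Prop) k :
  (forall u v, P u v -> Q u v) -> separable unit e Q k -> separable unit e P k.
Proof.
by move=> PQ [l [r [lr lrP]]]; exists l, r; split=> // u v /PQ; exact: lrP.
Qed.

Lemma separable_unit unit V (e P : V -> V -> Prop) k :
  separable true e P k -> separable unit e P k.
Proof.
move=> [l [r [lr lrP]]]; exists l, r; split=> // i.
by have [? /(_ isT) lr1 ?] := lr i; split.
Qed.

Lemma separable_sym unit V (e P : V -> V -> Prop) k : separable unit e P k ->
  separable unit e (fun u v => P u v \/ P v u) k.
Proof.
move=> [l [r [lr lrP]]]; exists l, r; split=> // u v [] /lrP[i s]; exists i => //.
by case: s; [right|left].
Qed.

Lemma separableU unit V (e P Q : V -> V -> Prop) k m :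
    separable unit e P k -> separable unit e Q m ->
  separable unit e (fun u v => P u v \/ Q u v) (k + m).
Proof.
move=> [l [r [lr lrP]]] [l' [r' [lr' lrP']]].
rewrite -[k]card_ord -[m]card_ord -card_sum.
pose L i := match i with inl j => l j | inr j => l' j end.
pose R' i := match i with inl j => r j | inr j => r' j end.
apply: (@separable_fin _ _ _ _ _ L R') => [[]//|u v].
by case=> [/lrP[i]|/lrP'[i]]; [exists (inl i)|exists (inr i)].
Qed.

Lemma separable_bigU unit V (e : V -> V -> Prop) (J : finType)
    (P : J -> V -> V -> Prop) k :
    (forall j, separable unit e (P j) k) ->
  separable unit e (fun u v => exists j, P j u v) (#|J| * k).
Proof.
move=> /choice[l /choice[r lrP]].
rewrite -[k]card_ord -card_prod.
pose L (i : J * 'I_k) := l i.1 i.2; pose R' (i : J * 'I_k) := r i.1 i.2.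
apply: (@separable_fin _ _ _ _ _ L R') => [[j i]|u v [j Pj]].
  by have [+ _] := lrP j; apply.
by have [_ /(_ _ _ Pj)[i]] := lrP j; exists (j, i).
Qed.

(** Intervals are pulled back along [h]; an edge contracted by [h] is harmless, since an interval
    meets itself. *)
Lemma separable_comp unit V V' (e : V -> V -> Prop) (e' P : V' -> V' -> Prop)
    (h : V -> V') k :
    (forall u v, e u v -> [\/ h u = h v, e' (h u) (h v) | e' (h v) (h u)]) ->
    separable unit e' P k ->
  separable unit e (fun u v => P (h u) (h v)) k.
Proof.
move=> he [l [r [lr lrP]]]; exists (fun i => l i \o h), (fun i => r i \o h).
split=> [i|u v /lrP//]; have [lri ri eri] := lr i.
split=> [u|un u|u v /he[]] /=; [exact: lri|exact: ri| | |].
- by move=> ->; split.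
- by move/eri.
- by case/eri; split.
Qed.

(** Intervals on [A] end at [f], those on [B] begin at [g], and the common length is so large that
    all other pairs meet. *)
Lemma separable_threshold (V : finType) (e : V -> V -> Prop) (A B : pred V)
    (f g : V -> R) :
    (forall u, A u -> ~~ B u) ->
    (forall u v, e u v \/ e v u -> A u -> B v -> g v <= f u) ->
  separable true e (fun u v => [/\ A u, B v & f u < g v]) 1.
Proof.
move=> AB fg; pose M := 1 + \sum_u (`|f u| + `|g u|).
have M_ge u : `|f u| + `|g u| <= M - 1.
  rewrite /M addrAC subrr add0r (bigD1 u) //= lerDl.
  by apply: sumr_ge0 => v _; exact: addr_ge0.
have fM u : - M <= f u <= M.
  rewrite -ler_norml; have := M_ge u; have := normr_ge0 (g u); lra.
have gM u : - M <= g u <= M.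
  rewrite -ler_norml; have := M_ge u; have := normr_ge0 (f u); lra.
(* Intervals of length 2M: [f - 2M, f] on A, [g, g + 2M] on B and [-M, M]
   elsewhere; dividing by 2M makes them unit. *)
pose L u := if A u then f u - 2 * M else if B u then g u else - M.
have L_le u v : A u && B v = false -> L v <= L u + 2 * M.
  rewrite /L; have := fM u; have := fM v; have := gM u; have := gM v.
  by case: (A u); case: (A v); case: (B u); case: (B v) => //= ????; lra.
have edge u v : e u v \/ e v u -> L u <= L v + 2 * M.
  move=> euv; case: (boolP (A v && B u)) => [/andP[Av Bu]|/negPf/L_le//].
  have /fg/(_ Av Bu) : e v u \/ e u v by case: euv; [right|left].
  have := fM v; have := gM u.
  have : ~~ A u by apply: contraL Bu; exact: AB.
  by rewrite /L Av Bu => /negPf ->; lra.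
have M0 : 0 < M by apply: ltr_pwDl => //; apply: sumr_ge0 => *; exact: addr_ge0.
pose l u := L u / (2 * M).
have l_le u v : L u <= L v + 2 * M -> l u <= l v + 1.
  by move=> luv; rewrite /l ler_pdivrMr ?mulrDl ?divfK ?mul1r //; lra.
exists (fun=> l), (fun _ u => l u + 1); split=> [_|u v [Au Bv fgv]].
  split=> // [u|u v euv]; first lra.
  by split; apply/l_le/edge; [left|right].
exists ord0; left; rewrite /l.
rewrite ltr_pdivlMr ?mulrDl ?divfK ?mul1r //; [|lra|lra].
have /negPf Av : ~~ A v by apply: contraL Bv; exact: AB.
by rewrite /L Au Av Bv; lra.
Qed.

End Separation.

(** * The hypercube *)

Section Hypercube.
Variables (R : realFieldType) (d : nat).
Implicit Types (S T : {set 'I_d}) (w : 'I_d -> int).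

Definition covers S T : Prop := S \subset T /\ #|T| = #|S|.+1.

Lemma coversP S T : covers S T -> exists2 x, x \notin S & T = x |: S.
Proof.
case=> ST cT; have /cards1P[x TS] : #|T :\: S| == 1%N.
  by rewrite cardsD (finset.setIidPr ST) cT subSnn.
exists x; first by have := finset.set11 x; rewrite -TS inE => /andP[].
rewrite -TS; apply/setP => y; rewrite !inE.
by have [/(fintype.subsetP ST)->|] := boolP (y \in S); rewrite ?orbT ?orbF.
Qed.

Lemma covers_differ S T x y : covers S T ->
  (x \in S) != (x \in T) -> (y \in S) != (y \in T) -> x = y.
Proof.
move=> /coversP[z zS ->]; rewrite !inE.
by have [->|_] := eqVneq x z; have [->|_] := eqVneq y z; rewrite //= !eqxx.
Qed.

Definition set_diff S T (x : 'I_d) : int := (x \in T)%:R - (x \in S)%:R.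

Lemma sign_set_diff S T : sign_vector (set_diff S T).
Proof. by move=> x; rewrite /set_diff; case: (_ \in T); case: (_ \in S). Qed.

Lemma sum_set_diff w S T :
  \sum_x w x * set_diff S T x = \sum_(x in T) w x - \sum_(x in S) w x.
Proof.
rewrite [X in X - _]big_mkcond [X in _ - X]big_mkcond -sumrB.
apply: eq_bigr => x _; rewrite /set_diff mulrBr.
by case: (x \in T); case: (x \in S); rewrite ?mulr1 ?mulr0.
Qed.

Lemma sum1_int S : \sum_(x in S) 1 = #|S|%:Z.
Proof. by rewrite sumr_const natz. Qed.

(* Every edge between the sets of sizes p and p + 1 modulo 4 goes up, as -1 and 1
   differ modulo 4. *)
Lemma separable_weight w (p : nat) : (forall x, 0 < w x) ->
  separable R true covers (fun T S =>
    [/\ (#|T| %% 4 = p.+1 %% 4)%N, (#|S| %% 4 = p)%N &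
        \sum_(x in T) w x <= \sum_(x in S) w x]) 1.
Proof.
move=> w0; pose s S : int := \sum_(x in S) w x.
apply: separable_sub (@separable_threshold R _ covers
  (fun T => #|T| %% 4 == p.+1 %% 4)%N (fun S => #|S| %% 4 == p)%N
  (fun T => (s T)%:~R) (fun S => (s S + 1)%:~R) _ _) => [T S [-> -> /= TS]||].
- by split; rewrite ?eqxx //= ltr_int ltzD1.
- by move=> T /= /eqP ->; apply/eqP; lia.
- move=> T S /= + /eqP Tp /eqP Sp; rewrite ler_int.
  case=> [[_ cS]|/coversP[x xS ->]]; first by move: #|T| #|S| Tp Sp cS; lia.
  by rewrite /s big_setU1 //= [leRHS]addrC lerD2l -gtz0_ge1.
Qed.

(** An edge between these classes raises the size by exactly 1, so a threshold on sizes cuts only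
    larger gaps. *)
Lemma separable_level (p : nat) :
  separable R true covers (fun T S =>
    [/\ (#|T| %% 4 = p.+1 %% 4)%N, (#|S| %% 4 = p)%N & (#|S|.+1 < #|T|)%N]) 1.
Proof.
apply: separable_sub (separable_sym (@separable_threshold R _ covers
  (fun S => #|S| %% 4 == p)%N (fun T => #|T| %% 4 == p.+1 %% 4)%N
  (fun S => #|S|.+1%:R) (fun T => #|T|%:R) _ _)) => [T S [-> -> ST]||].
- by right; rewrite !eqxx ltr_nat.
- by move=> S /= /eqP; lia.
- move=> S T /= + /eqP Sp /eqP Tp; rewrite ler_nat.
  by case=> -[_]; move: #|T| #|S| Tp Sp; lia.
Qed.

(** For each residue [p], constant weights treat [#|T| <= #|S|], levels treat [#|T| > #|S| + 1], and
    the reversing weights treat [#|T| = #|S| + 1], where [S] is not contained in [T]. *)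
Lemma separable_odd k : (d <= k`!)%N ->
  separable R true covers (fun S T =>
    [/\ odd (#|S| + #|T|), ~ covers S T & ~ covers T S])
    (4 * (2 + k.*2)).
Proof.
move=> /exists_reversing[w [w0 wP]].
pose P (p : 'I_4) T S := (#|T| %% 4 = p.+1 %% 4)%N /\ (#|S| %% 4 = p)%N.
have sepP p : separable R true covers (fun T S => P p T S /\ ~ covers S T)
    (2 + k.*2).
  have -> : (2 + k.*2 = 1 + 1 + #|{: bool * 'I_k}| * 1)%N.
    by rewrite card_prod card_bool card_ord; lia.
  apply: separable_sub (separableU (separableU
    (@separable_weight (fun=> 1) p (fun=> ltr01)) (separable_level p))
    (separable_bigU (fun i => @separable_weight (w i) p (w0 i)))).
  move=> T S [[Tp Sp] ST]; rewrite !sum1_int.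
  have [TS|TS] := leqP #|T| #|S|; first by left; left.
  have [ST1|ST1] := ltnP #|S|.+1 #|T|; first by left; right.
  have cT : #|T| = #|S|.+1 by lia.
  right; have [//|||i wi] := wP (set_diff S T).
  - exact: sign_set_diff.
  - have := sum_set_diff (fun=> 1) S T; under eq_bigr do rewrite mul1r.
    by move=> ->; rewrite !sum1_int cT; lia.
  - have /fintype.subsetPn[x xS xT] : ~~ (S \subset T) by apply/negP => sST; apply: ST.
    by exists x; rewrite /set_diff xS (negPf xT).
  by exists i; split=> //; rewrite -subr_le0 -sum_set_diff.
rewrite -[4%N in X in _ X]card_ord.
apply: separable_sub (separable_sym (separable_bigU sepP)).
move=> S T [oST nST nTS].
pose p S : 'I_4 := Ordinal (ltn_pmod #|S| (isT : 0 < 4)%N).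
have [TS|TS] := eqVneq (#|T| %% 4)%N (#|S|.+1 %% 4)%N; [right|left].
  by exists (p S); do 2?split=> //=; move: #|T| #|S| TS; lia.
by exists (p T); do 2?split=> //=; move: #|T| #|S| TS oST; lia.
Qed.

(** A sum of signs moves by exactly 1 along an edge, so the intervals [[s, s + 1]] of neighbours
    meet. It has the parity of the set, so for sets of equal parity distinct sums differ by at least
    2; detection provides distinct sums. *)
Lemma separable_even_unit k : (d * 2 <= 2 ^ k * k.+2)%N ->
  separable R true covers (fun S T => S != T /\ ~~ odd (#|S| + #|T|)) (2 ^ k.+1).
Proof.
move=> /exists_detecting[b bP].
have -> : (2 ^ k.+1 = #|{: bool * det_row k}|)%N.
  by rewrite card_prod card_bool card_det_row expnS.
pose s i S : int := \sum_(x in S) (-1) ^+ b i x.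
have parity i S : odd `|s i S|%N = odd #|S|.
  rewrite /s -sum1_card.
  elim/big_rec2: _ => // x m z _; case: (b i x); rewrite ?expr0 ?expr1; lia.
apply: (@separable_fin _ _ _ _ _ _ (fun i S => (s i S)%:~R)
    (fun i S => (s i S + 1)%:~R)) => [i|S T [ST oST]].
  split=> [S|_ S|S T /coversP[x xS ->]]; rewrite ?ler_int ?lerDl ?intrD //.
  rewrite /s big_setU1 //=; move: (\sum_(x in S) _) => t.
  by case: (b i x); rewrite ?expr0 ?expr1; lia.
have [i si] : exists i, s i S != s i T.
  apply: contrapT => /forallNP sST; case/eqP: ST.
  apply/setP => x; apply/eqP; have := bP _ (@sign_set_diff S T).
  move=> /(_ _ x); rewrite /set_diff => z0.
  have : (x \in T)%:R - (x \in S)%:R = 0 :> int.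
    apply: z0 => i; rewrite sum_set_diff; apply/eqP; rewrite subr_eq0 eq_sym.
    by apply/negPn/negP/sST.
  by case: (x \in T); case: (x \in S).
exists i; have := parity i S; have := parity i T; move: oST; rewrite oddD.
have [lt_st|lt_ts|] := ltgtP (s i S) (s i T); last by move/eqP: si.
  move=> oST oT oS; left; rewrite ltr_int; lia.
move=> oST oT oS; right; rewrite ltr_int; lia.
Qed.

(** For each parity, the sets of that parity become distinct points and all others receive the full
    range; no edge joins two sets of equal parity. *)
Lemma separable_even_box :
  separable R false covers (fun S T => S != T /\ ~~ odd (#|S| + #|T|)) 2.
Proof.
rewrite -card_bool.
pose N := #|{set 'I_d}|.
pose l c S : R := if odd #|S| == c then (enum_rank S)%:R else 0.
pose r c S : R := if odd #|S| == c then (enum_rank S)%:R else N%:R.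
apply: (@separable_fin _ _ _ _ _ _ l r) => [c|S T [ST oST]].
  split=> [S||S T [_ cT]] //; rewrite /l /r ?cT /=.
    by case: ifP => _ //; rewrite ler_nat.
  have SN := ltnW (ltn_ord (enum_rank S)).
  have TN := ltnW (ltn_ord (enum_rank T)).
  by case: (odd #|S|); case: c => /=; rewrite ?ler_nat ?ler0n.
exists (odd #|S|).
have /eqP oT : odd #|T| == odd #|S| by move: oST; rewrite oddD; case: odd; case: odd.
rewrite /separates /l /r oT eqxx !ltr_nat.
have : enum_rank S != enum_rank T by rewrite (inj_eq enum_rank_inj).
by rewrite -val_eqE /=; lia.
Qed.

Lemma separable_cube un k n : (d <= k`!)%N ->
    separable R un covers (fun S T => S != T /\ ~~ odd (#|S| + #|T|)) n ->
  separable R un covers (fun S T => [/\ S != T, ~ covers S T & ~ covers T S])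
    (4 * (2 + k.*2) + n).
Proof.
move=> /separable_odd/(separable_unit un) sepo sepe.
apply: separable_sub (separableU sepo sepe) => S T [ST nST nTS].
by case: (boolP (odd _)) => oST; [left|right].
Qed.

End Hypercube.

(** * Words over the vertices of a graph *)

Section Words.
Variables (R : realFieldType) (G : sgraph) (d : nat).
Local Notation word := {ffun 'I_d -> G}.
Implicit Types u v : word.

Definition differ_at i u v := forall j, j != i -> u j = v j.

Definition word_adj u v := exists2 i, adj (u i) (v i) & differ_at i u v.

(** Labels are summed in a cyclic group, so the number of values of [total] does not depend on
    [d]. *)
Let label (x : G) : 'I_#|G|.+1 := inord (enum_rank x).

Let label_inj : injective label.
Proof.
move=> x y /(congr1 val); rewrite /= !inordK ?ltnS ?(ltnW (ltn_ord _)) //.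
by move/val_inj/enum_rank_inj.
Qed.

Let total u := \sum_i label (u i).

Let total_differ i u v : differ_at i u v ->
  total u - total v = label (u i) - label (v i).
Proof.
move=> uv; rewrite /total -sumrB (bigD1 i) //= big1 ?addr0 // => j /uv ->.
by rewrite subrr.
Qed.

Let letters (a : G) u := #|[set i | u i == a]|.

Let letters_differ a i u v : differ_at i u v -> u i != a ->
  (letters a u <= letters a v)%N.
Proof.
move=> uv ua; apply/subset_leq_card/fintype.subsetP => j; rewrite !inE.
by have [->|/uv ->//] := eqVneq j i; rewrite (negPf ua).
Qed.

Let letters_lt a i u v : differ_at i u v -> u i != a -> v i = a ->
  (letters a u < letters a v)%N.
Proof.
move=> uv ua va; apply/proper_card/properP; split; last first.
  by exists i; rewrite inE ?va.
apply/fintype.subsetP => j; rewrite !inE.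
by have [->|/uv ->//] := eqVneq j i; rewrite (negPf ua).
Qed.

(* An edge from the class total = q to the class total = q + label a - label b
   cannot create a letter a: that letter would replace b, but a and b are not
   adjacent. So the number of letters a does not increase along such edges. *)
Lemma separable_nonedge (a b : G) : a != b -> ~~ adj a b ->
  separable R true word_adj (fun v u =>
    exists i, [/\ v i = b, u i = a & differ_at i v u]) #|'I_#|G|.+1|.
Proof.
move=> ab nab; rewrite -[#|_|]muln1.
apply: separable_sub (separable_bigU (fun q => @separable_threshold R word
  word_adj (fun v => total v == q) (fun u => total u == q + label a - label b)
  (fun v => (letters a v)%:R) (fun u => (letters a u)%:R) _ _)).
- move=> v u [i [vi ui vu]]; exists (total v); split; first exact: eqxx.
    by rewrite -[eqbLHS](subKr (total v)) (total_differ vu) vi ui opprB addrA.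
  by rewrite ltr_nat (letters_lt vu) ?vi // eq_sym.
- move=> q v /eqP ->; rewrite -addrA -[X in X == _]addr0.
  by rewrite (inj_eq (addrI q)) eq_sym subr_eq0 (inj_eq label_inj).
move=> q v u vu /eqP vq /eqP uq; rewrite ler_nat.
have [i auv uv] : word_adj u v.
  by case: vu => // -[i avu vu]; exists i; [rewrite adj_sym|move=> j /vu].
apply: (letters_differ uv); apply: contraNneq nab => uia.
have := total_differ uv; rewrite uq vq uia => /eqP.
rewrite -(addrA q) addrAC subrr add0r.
by move=> /eqP/addrI/oppr_inj/label_inj ->; rewrite -uia.
Qed.

Lemma separable_near :
  separable R true word_adj (fun u v =>
    exists i, [/\ u i != v i, ~~ adj (u i) (v i) & differ_at i u v])
    (#|{: G * G}| * #|'I_#|G|.+1|).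
Proof.
pose P (p : G * G) v u := [/\ p.1 != p.2, ~~ adj p.1 p.2 &
  exists i, [/\ v i = p.2, u i = p.1 & differ_at i v u]].
have sepP p : separable R true word_adj (P p) #|'I_#|G|.+1|.
  have [/andP[p12 np12]|np] := boolP ((p.1 != p.2) && ~~ adj p.1 p.2).
    by apply: separable_sub (separable_nonedge p12 np12) => v u [].
  exists (fun _ _ => 0), (fun _ _ => 1); split=> [_|v u [p12 np12]].
    by split=> *; rewrite ?add0r //; split.
  by rewrite p12 np12 in np.
apply: separable_sub (separable_bigU sepP) => v u [i [vu nvu dvu]].
by exists (u i, v i); split=> /=; rewrite 1?eq_sym // 1?adj_sym //; exists i.
Qed.

Let cut (phi : {ffun G -> bool}) u := [set i | phi (u i)].

Let cut_adj phi u v : word_adj u v ->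
  [\/ cut phi u = cut phi v, covers (cut phi u) (cut phi v) |
      covers (cut phi v) (cut phi u)].
Proof.
move=> [i _ uv].
have cover u' v' : differ_at i u' v' -> phi (u' i) = false -> phi (v' i) ->
    covers (cut phi u') (cut phi v').
  move=> uv' u'i v'i; have -> : cut phi v' = i |: cut phi u'.
    by apply/setP => j; rewrite !inE; have [->|/uv' ->] := eqVneq j i.
  by split; [exact: finset.subsetUr|rewrite cardsU1 inE u'i].
have vu : differ_at i v u by move=> j /uv.
case ui: (phi (u i)); case vi: (phi (v i)).
- apply: Or31; apply/setP => j; rewrite !inE.
  by have [->|/uv ->//] := eqVneq j i; rewrite ui.
- by apply: Or33; exact: cover.
- by apply: Or32; exact: cover.
- apply: Or31; apply/setP => j; rewrite !inE.
  by have [->|/uv ->//] := eqVneq j i; rewrite ui.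
Qed.

(** If neither the indicator of [a] nor that of [b] splits [c] from [e], then [c] and [e] avoid both
    [a] and [b], and the indicator of [a] and [c] works. *)
Lemma exists_cut2 (T : finType) (a b c e : T) : a != b -> c != e ->
  exists phi : {ffun T -> bool}, phi a != phi b /\ phi c != phi e.
Proof.
move=> ab ce.
have [|ac] := boolP ((c == a) != (e == a)).
  by exists [ffun x => x == a]; rewrite !ffunE eqxx [b == a]eq_sym (negPf ab).
have [|bc] := boolP ((c == b) != (e == b)).
  by exists [ffun x => x == b]; rewrite !ffunE eqxx (negPf ab).
have nce x : ~~ ((c == x) != (e == x)) -> c != x /\ e != x.
  rewrite negbK; case: (eqVneq c x) => [<-|_] /=; first by rewrite [e == c]eq_sym (negPf ce).
  by move=> /eqP <-.
have [ca ea] := nce _ ac; have [cb eb] := nce _ bc.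
exists [ffun x => (x == a) || (x == c)]; rewrite !ffunE !eqxx orbT /=.
rewrite [b == a]eq_sym (negPf ab) [b == c]eq_sym (negPf cb) (negPf ea).
by rewrite [e == c]eq_sym (negPf ce).
Qed.

(** A [phi] splitting the letters at both [i] and [j] sends the words to sets that differ in two
    places, hence neither equal nor adjacent. *)
Lemma separable_far un k :
    separable R un (@covers d)
      (fun S T => [/\ S != T, ~ covers S T & ~ covers T S]) k ->
  separable R un word_adj (fun u v =>
    exists i j, [/\ i != j, u i != v i & u j != v j])
    (#|{ffun G -> bool}| * k).
Proof.
move=> sepk.
apply: separable_sub (separable_bigU (fun phi => separable_comp (@cut_adj phi) sepk)).
move=> u v [i [j [ij ui uj]]]; have [phi [phii phij]] := exists_cut2 ui uj.
exists phi.
have cutN w (x y : word) : phi (x w) != phi (y w) ->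
    (w \in cut phi x) != (w \in cut phi y).
  by rewrite !inE.
split.
- by apply: contraNneq phii => cuv; have /setP/(_ i) := cuv; rewrite !inE => ->.
- move=> /covers_differ /(_ (cutN _ _ _ phii) (cutN _ _ _ phij)) ji.
  by rewrite ji eqxx in ij.
- move=> /covers_differ; rewrite eq_sym in phii; rewrite eq_sym in phij.
  move=> /(_ _ _ (cutN _ _ _ phii) (cutN _ _ _ phij)) ji.
  by rewrite ji eqxx in ij.
Qed.

Lemma separable_words un k :
    separable R un (@covers d)
      (fun S T => [/\ S != T, ~ covers S T & ~ covers T S]) k ->
  separable R un word_adj (fun u v => u != v /\ ~ word_adj u v)
    (#|{: G * G}| * #|'I_#|G|.+1| + #|{ffun G -> bool}| * k).
Proof.
move=> /separable_far sepf.
apply: separable_sub (separableU (separable_unit un separable_near) sepf).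
move=> u v [uv nuv].
have [i ui] : exists i, u i != v i.
  apply/existsP; apply: contraNT uv => /existsPn uv.
  by apply/eqP/ffunP => i; apply/eqP/negPn/uv.
have [/existsP[j /andP[ji uj]]|/existsPn uv'] :=
    boolP [exists j, (j != i) && (u j != v j)].
  by right; exists i, j; rewrite eq_sym.
have duv : differ_at i u v.
  by move=> j ji; have := uv' j; rewrite ji /= negbK => /eqP.
by left; exists i; split=> //; apply/negP => auv; apply: nuv; exists i.
Qed.

End Words.

(** * Cartesian powers *)

Section Coordinates.
Variable G : sgraph.

Fixpoint of_word d : {ffun 'I_d -> G} -> cart_pow G d :=
  if d is d'.+1 return {ffun 'I_d -> G} -> cart_pow G d then
    fun u => (u ord0, of_word [ffun i => u (lift ord0 i)])
  else fun=> tt.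

Lemma of_word_surj d (x : cart_pow G d) : exists u, of_word u = x.
Proof.
elim: d x => [|d IHd] /=; first by case; exists (ffun0 (card_ord 0)).
move=> [a x]; have [u ux] := IHd x.
exists [ffun i => if unlift ord0 i is Some j then u j else a].
rewrite ffunE unlift_none -ux; congr (_, of_word _).
by apply/ffunP => i; rewrite !ffunE liftK.
Qed.

Lemma of_word_inj d : injective (@of_word d).
Proof.
elim: d => [|d IHd] u v /=; first by move=> _; apply/ffunP => -[].
move=> [uv0 /IHd/ffunP uv]; apply/ffunP => i.
case: (unliftP ord0 i) => [j ->|-> //].
by have := uv j; rewrite !ffunE.
Qed.

Lemma of_word_adj d (u v : {ffun 'I_d -> G}) :
  adj (of_word u) (of_word v) <-> word_adj u v.
Proof.
elim: d u v => [|d IHd] u v /=; first by split=> // -[[]].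
rewrite /cart_adj /= (inj_eq (@of_word_inj d)); split.
  case/orP=> [/andP[/eqP uv0 /IHd[i]]|/andP[uv0 /eqP/ffunP uv]].
    rewrite !ffunE => uvi uv; exists (lift ord0 i) => // j.
    case: (unliftP ord0 j) => [j' ->|-> //].
    by rewrite (inj_eq lift_inj) => /uv; rewrite !ffunE.
  exists ord0 => // j; case: (unliftP ord0 j) => [j' ->|->]; last by rewrite eqxx.
  by have := uv j'; rewrite !ffunE.
move=> [i]; case: (unliftP ord0 i) => [i' ->|->] uvi uv; apply/orP; [left|right].
  rewrite (uv ord0) // eqxx; apply/IHd; exists i'; rewrite ?ffunE // => j ji.
  by rewrite !ffunE uv // (inj_eq lift_inj).
by rewrite uvi; apply/eqP/ffunP => j; rewrite !ffunE uv.
Qed.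

Lemma cart_pow_separable (R : realFieldType) d un k :
    separable R un (@word_adj G d) (fun u v => u != v /\ ~ word_adj u v) k ->
  separable R un (fun x y : cart_pow G d => adj x y)
    (fun x y => x != y /\ ~~ adj x y) k.
Proof.
have [h hK] := choice (@of_word_surj d).
have he (x y : cart_pow G d) : adj x y ->
    [\/ h x = h y, word_adj (h x) (h y) | word_adj (h y) (h x)].
  by move=> xy; apply/Or32/of_word_adj; rewrite !hK.
move=> /(separable_comp he); apply: separable_sub => x y [xy nxy]; split.
  by apply: contraNneq xy => hxy; rewrite -(hK x) hxy hK.
by move=> /of_word_adj; rewrite !hK; apply/negP.
Qed.

End Coordinates.

(** * Interval supergraphs and box or cube representations *)

Section Representations.
Variables (R : realType) (H : sgraph).
Local Open Scope classical_set_scope.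
Local Open Scope ring_scope.

Let box_of k (l r : 'I_k -> H -> R) (v : H) : set 'rV[R]_k :=
  [set x | forall i, x ord0 i \in `[l i v, r i v]].

Lemma box_ofI k (l r : 'I_k -> H -> R) u v :
  (forall i v, l i v <= r i v) ->
  (box_of l r u `&` box_of l r v !=set0) <->
    forall i, l i u <= r i v /\ l i v <= r i u.
Proof.
move=> lr; split=> [[x [xu xv]] i|uv].
  have := xu i; have := xv i; rewrite !in_itv /= => /andP[? ?] /andP[? ?].
  by split; apply: le_trans; eassumption.
exists (\row_i Num.max (l i u) (l i v)); split=> i;
  rewrite mxE in_itv /= le_max ge_max lexx ?orbT !lr /=.
- by have [] := uv i.
- by have [-> _] := uv i.
Qed.

Lemma separable_rep k (l r : 'I_k -> H -> R) un :
    (forall i, interval_supergraph un (fun u v : H => adj u v) (l i) (r i)) ->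
    (forall u v : H, u != v /\ ~~ adj u v -> exists i, separates (l i) (r i) u v) ->
  intersection_rep (box_of l r).
Proof.
move=> lr sep u v uv; rewrite box_ofI => [|i]; last by have [] := lr i.
split=> [auv i|luv]; first by have [_ _ /(_ _ _ auv)] := lr i.
apply: contrapT => /negP nuv; have [//|i] := sep u v.
have [luv1 lvu] := luv i.
by case; rewrite ltNge ?luv1 ?lvu.
Qed.

Lemma boxicity_le k :
  separable R false (fun u v : H => adj u v)
    (fun u v => u != v /\ ~~ adj u v) k -> (boxicity R H <= k)%N.
Proof.
move=> [l [r [lr sep]]]; rewrite /boxicity; case: ex_minnP => m _; apply.
apply/asboolP; exists (box_of l r); split; last exact: separable_rep sep.
by move=> v; exists (l^~ v), (r^~ v); split=> // i; have [] := lr i.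
Qed.

Lemma cubicity_le k :
  separable R true (fun u v : H => adj u v)
    (fun u v => u != v /\ ~~ adj u v) k -> (cubicity R H <= k)%N.
Proof.
move=> [l [r [lr sep]]]; rewrite /cubicity; case: ex_minnP => m _; apply.
apply/asboolP; exists (box_of l r); split; last exact: separable_rep sep.
move=> v; exists (l^~ v); apply/seteqP; split=> x /= xv i;
  by have := xv i; have [_ /(_ isT) -> _] := lr i.
Qed.

Lemma boxicity_rep : exists l r : 'I_(boxicity R H) -> H -> R,
  (forall i v, l i v <= r i v) /\
  forall u v, u != v ->
    (adj u v <-> forall i, l i u <= r i v /\ l i v <= r i u).
Proof.
rewrite /boxicity; case: ex_minnP => k /asboolP[f [fb fr]] _.
have /choice[l /choice[r lr]] : forall v, exists a b : 'I_k -> R,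
  (forall i, a i <= b i) /\ f v = [set x | forall i, x ord0 i \in `[a i, b i]].
  exact: fb.
exists (fun i v => l v i), (fun i v => r v i); split=> [i v|u v /fr ->].
  by have [] := lr v.
have [_ ->] := lr u; have [_ ->] := lr v.
by apply: (@box_ofI _ (fun i => l^~ i) (fun i => r^~ i)) => i v'; have [] := lr v'.
Qed.

Lemma cubicity_rep : exists l : 'I_(cubicity R H) -> H -> R,
  forall u v, u != v ->
    (adj u v <-> forall i, l i u <= l i v + 1 /\ l i v <= l i u + 1).
Proof.
rewrite /cubicity; case: ex_minnP => k /asboolP[f [fb fr]] _.
have /choice[l fl] : forall v, exists a : 'I_k -> R,
  f v = [set x | forall i, x ord0 i \in `[a i, a i + 1]].
  exact: fb.
exists (fun i v => l v i) => u v /fr ->.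
rewrite (fl u) (fl v).
by apply: (@box_ofI _ (fun i => l^~ i) (fun i v => l v i + 1)) => i v'; rewrite lerDl.
Qed.

End Representations.

Section UpperBounds.
Variables (R : realType) (G : sgraph).

Let a := (#|{: G * G}| * #|'I_#|G|.+1|)%N.
Let b := #|{ffun G -> bool}|.

Lemma boxicity_cart_pow_le d k : (d <= k`!)%N ->
  (boxicity R (cart_pow G d) <= a + b * (4 * (2 + k.*2) + 2))%N.
Proof.
move=> dk; apply/boxicity_le/cart_pow_separable/separable_words.
exact/separable_cube/separable_even_box.
Qed.

Lemma cubicity_cart_pow_le d k m : (d <= k`!)%N -> (d * 2 <= 2 ^ m * m.+2)%N ->
  (cubicity R (cart_pow G d) <= a + b * (4 * (2 + k.*2) + 2 ^ m.+1))%N.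
Proof.
move=> dk dm; apply/cubicity_le/cart_pow_separable/separable_words.
exact/separable_cube/separable_even_unit.
Qed.

End UpperBounds.

(** * Lower bounds from a hypercube embedded along one edge *)

Section LowerBounds.
Variables (R : realType) (G : sgraph) (x y : G).
Hypothesis xy : adj x y.
Variable d : nat.

Let vert (S : {set 'I_d}) : cart_pow G d :=
  of_word [ffun i => if i \in S then y else x].

Let neq_xy : x != y.
Proof. by apply: contraTneq xy => ->; rewrite adj_irr. Qed.

Let vert_inj : injective vert.
Proof.
move=> S T /of_word_inj/ffunP ST; apply/setP => i; have := ST i; rewrite !ffunE.
by case: (i \in S); case: (i \in T) => // /eqP; rewrite ?[y == x]eq_sym (negPf neq_xy).
Qed.

Let vert_adj (S : {set 'I_d}) i : i \notin S -> adj (vert S) (vert (i |: S)).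
Proof.
move=> iS; apply/of_word_adj; exists i; first by rewrite !ffunE (negPf iS) setU11.
by move=> j ji; rewrite !ffunE !inE (negPf ji).
Qed.

Let vert_adj_parity (S T : {set 'I_d}) : adj (vert S) (vert T) ->
  odd #|S| != odd #|T|.
Proof.
have parity (S' T' : {set 'I_d}) i : i \in S' -> i \notin T' ->
    differ_at i [ffun i => if i \in S' then y else x]
                [ffun i => if i \in T' then y else x] -> odd #|S'| != odd #|T'|.
  move=> iS iT ST; suff -> : S' = i |: T' by rewrite cardsU1 iT /=; case: odd.
  apply/setP => j; rewrite !inE; have [->//|/ST] := eqVneq j i.
  rewrite !ffunE; case: (j \in S'); case: (j \in T') => // /eqP;
    by rewrite ?[y == x]eq_sym (negPf neq_xy).
move=> /of_word_adj[i]; rewrite !ffunE.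
case iS: (i \in S); case iT: (i \in T); rewrite ?adj_irr // => _ ST.
- by apply: parity ST; rewrite ?iT.
- by rewrite eq_sym; apply: (@parity _ _ i); rewrite ?iS // => j /ST.
Qed.

(** Each left endpoint moves by at most 1 along an edge, so it stays within [d] of that of the empty
    set; shifted by [d], it has [2d + 1] possible integer parts. Sets with equal integer parts have
    meeting cubes, so if distinct they are adjacent and differ in parity. *)
Lemma cubicity_cart_pow_ge :
  (2 ^ d <= 2 * (d.*2.+1) ^ cubicity R (cart_pow G d))%N.
Proof.
have [l lP] := cubicity_rep R (cart_pow G d); move: (cubicity _ _) l lP => k l lP.
have step i (S : {set 'I_d}) j : j \notin S ->
    l i (vert S) <= l i (vert (j |: S)) + 1 /\
    l i (vert (j |: S)) <= l i (vert S) + 1.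
  move=> jS; have ne : vert S != vert (j |: S).
    by rewrite (inj_eq vert_inj); apply: contraNneq jS => ->; rewrite setU11.
  by have [/(_ (vert_adj jS))/(_ i)] := lP _ _ ne.
have dist i (S : {set 'I_d}) : `|l i (vert S) - l i (vert finset.set0)| <= #|S|%:R.
  have [n] : exists n, #|S| = n by exists #|S|.
  elim: n S => [|n IHn] S cS.
    by rewrite (cards0_eq cS) subrr normr0 cards0.
  have /set0Pn[j jS] : S != finset.set0 by rewrite -cards_eq0 cS.
  have jSj : j \notin S :\ j by rewrite !inE eqxx.
  have cSj : #|S :\ j| = n by move: cS; rewrite (cardsD1 j) jS => -[].
  have := IHn _ cSj; have := step i _ _ jSj; rewrite finset.setD1K // cS cSj -natr1.
  by rewrite !ler_norml => -[? ?] /andP[? ?]; apply/andP; split; lra.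
pose h i (S : {set 'I_d}) := l i (vert S) - l i (vert finset.set0) + d%:R.
have cardS (S : {set 'I_d}) : #|S|%:R <= d%:R :> R.
  by have := max_card (mem S); rewrite card_ord ler_nat.
have h_bound i S : 0 <= h i S <= d.*2%:R.
  have := dist i S; have := cardS S; rewrite ler_norml /h -muln2 natrM => ?.
  by move=> /andP[? ?]; apply/andP; split; lra.
have h_lt i S : (Num.truncn (h i S) < d.*2.+1)%N.
  have /andP[h0 h1] := h_bound i S.
  by rewrite truncn_lt_nat // -natr1; lra.
pose F (S : {set 'I_d}) :=
  ([ffun i => inord (Num.truncn (h i S)) : 'I_d.*2.+1], odd #|S|).
have F_inj : injective F.
  move=> S T [/ffunP ST oST]; apply: contrapT => /eqP neST.
  have : adj (vert S) (vert T).
    apply/lP => [|i]; first by rewrite (inj_eq vert_inj).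
    have := ST i; rewrite !ffunE => /(congr1 val); rewrite /= !inordK // => hST.
    have /andP[/truncn_itv + _] := h_bound i S.
    have /andP[/truncn_itv + _] := h_bound i T.
    rewrite hST /h -natr1 => /andP[? ?] /andP[? ?]; split; lra.
  by move=> /vert_adj_parity; rewrite oST eqxx.
have := leq_card F F_inj.
rewrite -[X in (X <= _)%N]cardsT -powersetT card_powerset cardsT.
by rewrite card_prod card_ffun !card_ord card_bool mulnC.
Qed.

(* A vertex j is determined by the colours of the pairs (i, j), i < j, unless
   some colour occurs both below and above j. *)
Lemma monochromatic_path n (C : finType) (c : 'I_n -> 'I_n -> C) :
  (2 ^ #|C| < n)%N -> exists i j m : 'I_n, [/\ (i < j)%N, (j < m)%N & c i j = c j m].
Proof.
move=> Cn; pose F (j : 'I_n) := [set c i j | i : 'I_n & (i < j)%N].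
have /injectivePn[j [m jm Fjm]] : ~~ injectiveb F.
  apply: contraTN Cn => /injectiveP/leq_card; rewrite -leqNgt.
  by rewrite card_ord -cardsT -powersetT card_powerset cardsT.
wlog {jm} jm : j m Fjm / (j < m)%N.
  move=> wl; have := jm; rewrite -val_eqE neq_ltn => /orP[]; exact: wl.
have : c j m \in F m by apply/imsetP; exists j; rewrite ?inE.
by rewrite -Fjm => /imsetP[i]; rewrite inE => ij cE; exists i, j, m.
Qed.

Lemma boxicity_cart_pow_ge :
  (d <= 2 ^ 2 ^ (boxicity R (cart_pow G d)).*2)%N.
Proof.
have [l [r [lr lrP]]] := boxicity_rep R (cart_pow G d).
move: (boxicity _ _) l r lr lrP => k l r lr lrP; rewrite leqNgt; apply/negP => dk.
pose pt (i : 'I_d) := vert [set i].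
pose c i j : {ffun bool * 'I_k -> bool} := [ffun bt : bool * 'I_k =>
  if bt.1 then l bt.2 (pt i) <= l bt.2 (pt j)
  else r bt.2 (pt i) <= r bt.2 (pt j)].
have [|i [j [m [ij jm cijm]]]] := @monochromatic_path d _ c.
  by rewrite card_ffun card_prod !card_bool card_ord mul2n.
have im : i != m by rewrite -val_eqE /= neq_ltn (ltn_trans ij jm).
have {}ij : i != j by rewrite -val_eqE /= neq_ltn ij.
have {}jm : j != m by rewrite -val_eqE /= neq_ltn jm.
pose p := vert [set i; m].
have pt_p q q' : q != q' -> adj (pt q) (vert [set q'; q]).
  by move=> qq'; apply: vert_adj; rewrite inE eq_sym.
have pE q : q = i \/ q = m -> forall t, l t (pt q) <= r t p /\ l t p <= r t (pt q).
  move=> qim; have ap : adj (pt q) p.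
    case: qim => ->; last by apply: pt_p; rewrite eq_sym.
    by rewrite /p finset.setUC; apply: pt_p.
  apply/lrP => //; apply: contraTneq ap => ->; rewrite adj_irr //.
have : adj (pt j) p.
  apply/lrP => [|t].
    rewrite (inj_eq vert_inj); apply: contraNneq ij => /setP/(_ i).
    by rewrite !inE eqxx.
  have [li ri] := pE i (or_introl erefl) t.
  have [lm rm] := pE m (or_intror erefl) t.
  (* In each coordinate, the left end of [j] is at most the larger of those of [i] and [m], and its
     right end at least the smaller of theirs; both of these boxes meet that of [p]. *)
  have /ffunP cc := cijm; split.
    have := cc (true, t); rewrite !ffunE /=.
    by case: leP => [? /esym ?|? /esym/negbT]; rewrite -?ltNge; lra.
  have := cc (false, t); rewrite !ffunE /=.
  by case: leP => [? /esym ?|? /esym/negbT]; rewrite -?ltNge; lra.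
(* The sets [{j}] and [{i, m}] differ at both [i] and [m], so they cannot agree off a single [q]. *)
move=> /of_word_adj[q _ dq].
have val_q s : s != q -> (s == j) = (s == i) || (s == m).
  move=> /dq; rewrite !ffunE !inE; case: (s == j); case: (_ || _) => // /eqP;
  by rewrite ?[y == x]eq_sym (negPf neq_xy).
have [iq|/val_q] := eqVneq i q; last by rewrite eqxx (negPf ij).
have /val_q : m != q by rewrite -iq eq_sym.
by rewrite eqxx orbT eq_sym (negPf jm).
Qed.

End LowerBounds.

(** * Asymptotics *)

Section Log2.
Variable R : realType.
Implicit Types x y : R.

Lemma ln2_gt0 : 0 < ln (2 : R).
Proof. by apply: ln_gt0; lra. Qed.

Lemma log2M x y : 0 < x -> 0 < y -> log2 (x * y) = log2 x + log2 y.
Proof. by move=> x0 y0; rewrite /log2 lnM ?posrE // mulrDl. Qed.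

Lemma log2X x n : 0 < x -> log2 (x ^+ n) = n%:R * log2 x.
Proof. by move=> x0; rewrite /log2 lnXn // mulrA mulr_natl. Qed.

Lemma log2_2X n : log2 (2 ^+ n : R) = n%:R.
Proof. by rewrite log2X // /log2 divff ?mulr1 // gt_eqF // ln2_gt0. Qed.

Lemma ler_log2 x y : 0 < x -> x <= y -> log2 x <= log2 y.
Proof.
move=> x0 xy; rewrite ler_pM2r ?invr_gt0 ?ln2_gt0 //.
by rewrite ler_ln ?posrE // (lt_le_trans x0).
Qed.

Lemma log2_ge1 x : 2 <= x -> 1 <= log2 x.
Proof. by move=> x2; rewrite -[leLHS](log2_2X 1) ler_log2 ?expr1. Qed.

Lemma log2_le x : 0 < x -> log2 x <= 2 * x.
Proof.
move=> x0; have ln2 : 1 / 2 <= ln (2 : R).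
  (* The bound [ln (1 + x) <= x] at [x = - 1/2]. *)
  have := @le_ln1Dx R (- 2^-1); rewrite -[1 + _](_ : 2^-1 = _); last lra.
  by rewrite lnV ?posrE // => /(_ _); lra.
rewrite ler_pdivrMr ?ln2_gt0 //; have := ln_sublinear x0.
by have : x * (1 / 2) <= x * ln 2; [rewrite ler_pM2l|lra].
Qed.

Lemma le_log2_nat (n m : nat) : (0 < n)%N -> (n <= 2 ^ m)%N ->
  log2 (n%:R : R) <= m%:R.
Proof.
by move=> n0 nm; rewrite -[leRHS]log2_2X ler_log2 ?ltr0n // -natrX ler_nat.
Qed.

End Log2.

(** Pairing the factors [i + 1] and [n - i] of two copies of the factorial gives products at least
    [n]. *)
Lemma leq_expn_fact n : (n ^ n <= n`! ^ 2)%N.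
Proof.
have factE : n`! = (\prod_(i < n) i.+1)%N.
  by rewrite fact_prod big_add1 /= big_mkord.
rewrite -mulnn {1}factE (reindex_inj rev_ord_inj) factE -big_split /=.
rewrite -[X in (n ^ X <= _)%N]card_ord -prod_nat_const leq_prod // => i _.
by rewrite /= subnSK // -[leqLHS](subnK (ltnW (ltn_ord i)));
  rewrite mulnS leq_add2l leq_pmull ?subn_gt0.
Qed.

Section Growth.
Variable R : realType.

Lemma double_log2_le (d k : nat) : (2 <= d)%N -> (d <= 2 ^ 2 ^ k)%N ->
  log2 (log2 (d%:R : R)) <= k%:R.
Proof.
move=> d2 dk; have log_d : 1 <= log2 (d%:R : R) by rewrite log2_ge1 // ler_nat.
rewrite -[leRHS](log2_2X R); apply: ler_log2; first by lra.
by rewrite -natrX; apply: le_log2_nat; rewrite // (leq_trans _ d2).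
Qed.

(** Since [2d + 1 <= d ^ 3], logarithms give [d <= 1 + 3 k log d]; absorbing [1 <= d / 2] doubles
    the constant 3. *)
Lemma div_log2_le (d k : nat) : (2 <= d)%N -> (2 ^ d <= 2 * d.*2.+1 ^ k)%N ->
  d%:R / log2 (d%:R : R) <= 6 * k%:R.
Proof.
move=> d2 dk; have log_d : 1 <= log2 (d%:R : R) by rewrite log2_ge1 // ler_nat.
have d3 : (2 ^ d <= 2 * d ^ (3 * k))%N.
  apply: leq_trans dk _; rewrite leq_mul2l /= expnM.
  by case: k => [|k]; rewrite ?expn0 // leq_exp2r // !expnS expn0; nia.
have : d%:R <= 1 + 3 * k%:R * log2 (d%:R : R).
  have d0 : 0 < d%:R :> R by rewrite ltr0n; lia.
  rewrite -natrM -log2X // -[X in X + _](log2_2X R 1) -log2M ?exprn_gt0 //.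
  rewrite -[leLHS](log2_2X R) ler_log2 ?exprn_gt0 //.
  by rewrite -!natrX -natrM ler_nat.
rewrite ler_pdivrMr; last by lra.
have : 2 <= d%:R :> R by rewrite ler_nat.
lra.
Qed.

(** The least [m] with the first property works: minimality bounds [2 ^ m * m] by [4 d], while
    [log d <= 2 m]. The crude choice of [2 ^ m + 1] branches costs no more than the order of the
    detecting rows. *)
Lemma pow2_le_div_log2 (d : nat) : (2 <= d)%N -> exists m : nat,
  [/\ (d * 2 <= 2 ^ m * m.+2)%N, (d <= (2 ^ m).+1`!)%N &
      (2 ^ m)%:R <= 8 * (d%:R / log2 (d%:R : R))].
Proof.
move=> d2; have ex : exists m, (d * 2 <= 2 ^ m * m.+2)%N.
  by exists d; apply: leq_mul; [exact/ltnW/ltn_expl|lia].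
case: (ex_minnP ex) => m dm m_min; exists m; split=> //.
  rewrite factS; have : (m < 2 ^ m)%N by exact: ltn_expl.
  by have := fact_geq (2 ^ m); nia.
case: m dm m_min => [|m dm m_min]; first by lia.
have dm' : (2 ^ m * m.+2 < d * 2)%N.
  by rewrite ltnNge; apply/negP => /m_min; rewrite ltnn.
have log_d : 1 <= log2 (d%:R : R) by rewrite log2_ge1 // ler_nat.
have log_d_le : log2 (d%:R : R) <= (2 * m.+1)%:R.
  apply: le_log2_nat; first by lia.
  have : (m.+1 < 2 ^ m.+1)%N by exact: ltn_expl.
  by rewrite mul2n -addnn expnD; nia.
rewrite mulrA ler_pdivlMr; last by lra.
apply: le_trans (_ : (2 ^ m.+1)%:R * (2 * m.+1)%:R <= _).
  by rewrite ler_pM2l // ltr0n expn_gt0.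
by rewrite -!natrM ler_nat expnS; nia.
Qed.

(** For the least [k = j + 1], [j ^ j <= j! ^ 2 < d ^ 2] gives [j log j <= 2 y] with [y = log d]. If
    [j] exceeds the square root of [y], then [log j >= (log y) / 2]; otherwise [log y <= 4 sqrt y]
    suffices. *)
Lemma fact_inverse_le (d : nat) : (5 <= d)%N -> exists k : nat,
  [/\ (d <= k`!)%N, (0 < k)%N &
      k%:R <= 8 * (log2 (d%:R : R) / log2 (log2 (d%:R : R)))].
Proof.
move=> d5; have ex : exists k, (d <= k`!)%N by exists d; exact: fact_geq.
case: (ex_minnP ex) => -[|j] dj j_min; first by rewrite fact0 in dj; lia.
exists j.+1; split=> //.
have {}dj : (j`! < d)%N by rewrite ltnNge; apply/negP => /j_min; rewrite ltnn.
set y := log2 d%:R; have y2 : 2 <= y.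
  by rewrite -[leLHS](log2_2X R 2) ler_log2 ?exprn_gt0 // -natrX ler_nat; lia.
have ly1 : 1 <= log2 y by exact: log2_ge1.
pose t := Num.sqrt y; have tt : t ^+ 2 = y by rewrite sqr_sqrtr //; lra.
have t0 : 0 < t by rewrite sqrtr_gt0; lra.
have lyt : log2 y = 2 * log2 t by rewrite -tt log2X.
have ly_le : log2 y <= 4 * t by rewrite lyt; have := log2_le t0; lra.
have ly_le2 : log2 y <= 2 * y by apply: log2_le; lra.
rewrite mulrA ler_pdivlMr; last by lra.
have [jt|tj] := lerP j%:R t.
  have : j%:R * log2 y <= t * (4 * t) by apply: ler_pM; rewrite ?ler0n //; lra.
  have -> : t * (4 * t) = 4 * y by rewrite -tt; ring.
  by rewrite -natr1 mulrDl mul1r; lra.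
have j0 : 0 < j%:R :> R by lra.
have : j%:R * log2 j%:R <= 2 * y.
  rewrite -log2X // -/y -log2X ?ltr0n; last by lia.
  rewrite ler_log2 ?exprn_gt0 // -!natrX ler_nat.
  apply: leq_trans (leq_expn_fact j) _; rewrite leq_exp2r //; lia.
have : j%:R * log2 t <= j%:R * log2 j%:R by rewrite ler_pM2l // ler_log2 // ltW.
by rewrite -natr1 mulrDl mul1r lyt; lra.
Qed.

End Growth.

Local Open Scope classical_set_scope.
Local Open Scope ring_scope.

Lemma eqO_ge (R : realType) (f g : nat -> R) (N : nat) (C : R) : 0 < C ->
  (forall d, (N <= d)%N -> `|f d| <= C * `|g d|) -> f =O_\oo g.
Proof. by move=> C0 fg; apply/eqO_exP; exists C => //; exists N. Qed.

Theorem corollary7 (R : realType) (G : sgraph)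
  (hG : exists u v : G, adj u v) :
  let box (d : nat) : R := (boxicity R (cart_pow G d))%:R in
  let cub (d : nat) : R := (cubicity R (cart_pow G d))%:R in
  [/\ box =O_\oo (fun d : nat => log2 (d%:R : R) / log2 (log2 (d%:R : R))),
      box \is 'Omega_\oo(fun d : nat => log2 (log2 (d%:R : R)))
    & cub \is 'Theta_\oo(fun d : nat => (d%:R : R) / log2 (d%:R : R))].
Proof.
have [x [y xy]] := hG => box cub.
pose a := (#|{: G * G}| * #|'I_#|G|.+1|)%N; pose b := #|{ffun G -> bool}|.
have log_ge1 d : (2 <= d)%N -> 1 <= log2 (d%:R : R).
  by move=> d2; rewrite log2_ge1 // ler_nat.
have scale (M : R) (k g : R) : 0 < M -> k <= 8 * g -> M * k <= 8 * M * `|g|.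
  move=> M0 kg; rewrite [8 * M]mulrC -mulrA ler_pM2l // (le_trans kg) //.
  by rewrite ler_pM2l // ler_norm.
split.
(* As [k >= 1], [4 * (2 + 2k) + 2 <= 18 k]; the extra 1 keeps the constant positive. *)
- apply: (@eqO_ge _ _ _ 5 (8 * (1 + a + 18 * b)%:R)); first by rewrite mulr_gt0.
  move=> d d5; have [k [dk k0 k_le]] := fact_inverse_le R d5.
  rewrite ger0_norm //; apply: le_trans (scale _ _ _ _ k_le) => //.
  have := boxicity_cart_pow_le R G dk; rewrite -/a -/b => box_le.
  by rewrite -natrM ler_nat; nia.
- rewrite eqOmegaO; apply: (@eqO_ge _ _ _ 4 2) => // d d4.
  have d2 : (2 <= d)%N by lia.
  have log_d2 : 2 <= log2 (d%:R : R).
    by rewrite -[leLHS](log2_2X R 2) ler_log2 ?exprn_gt0 // -natrX ler_nat.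
  rewrite normr_nat ger0_norm; last by have := log2_ge1 log_d2; lra.
  have := double_log2_le R d2 (boxicity_cart_pow_ge R xy d).
  by rewrite -muln2 natrM mulrC.
rewrite bigThetaE eqOmegaO; split.
(* With [n = 2 ^ m] and [k = n + 1], [4 * (2 + 2k) + 2n = 10n + 16 <= 26n]. *)
- apply: (@eqO_ge _ _ _ 2 (8 * (1 + a + 26 * b)%:R)); first by rewrite mulr_gt0.
  move=> d d2; have [m [dm dk m_le]] := pow2_le_div_log2 R d2.
  rewrite ger0_norm //; apply: le_trans (scale _ _ _ _ m_le) => //.
  have := cubicity_cart_pow_le R G dk dm; rewrite -/a -/b expnS => cub_le.
  have : (0 < 2 ^ m)%N by rewrite expn_gt0.
  by rewrite -natrM ler_nat; move: (2 ^ m)%N cub_le => n; nia.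
apply: (@eqO_ge _ _ _ 2 6) => // d d2.
rewrite normr_nat ger0_norm.
  exact: div_log2_le d2 (cubicity_cart_pow_ge R xy d).
by rewrite divr_ge0 //; have := log_ge1 d d2; lra.
Qed.
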